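(* Let $\boldsymbol{Y}$ be a Lévy process in $\mathbb{R}^d$, let $\lambda>0$, and let $\boldsymbol{X}$ be the process obtained from $\boldsymbol{Y}$ by total resetting to the origin at the arrival times of an independent Poisson process of intensity $\lambda$. For all $\lambda>0$, $t>0$, $x\in\mathbb{R}^d$ and Borel sets $A\subset\mathbb{R}^d$, $$\mathbb{P}^x(X_t\in A)=e^{-\lambda t}\,\mathbb{P}^x(Y_t\in A)+\int_0^t\lambda e^{-\lambda s}\,\mathbb{P}^0(Y_s\in A)\,ds.$$ In particular, if for every $t>0$ the random variable $Y_t$ is absolutely continuous with respect to the Lebesgue measure with density $p(t,\cdot)$ (under $\mathbb{P}^0$), then $X_t$ is also absolutely continuous for every $t>0$, with a density $p_\lambda(t,x,y)$ (under $\mathbb{P}^x$) given by $$p_\lambda(t,x,y)=e^{-\lambda t}p(t,y-x)+\int_0^t\lambda e^{-\lambda s}p(s,y)\,ds,\qquad t>0,\ x,y\in\mathbb{R}^d.$$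
   Context: Let $d\in\{1,2,\dots\}$. A Lévy process is a stochastic process with stationary and independent increments, continuous in probability (with càdlàg paths). Under $\mathbb{P}^x$ the process $\boldsymbol{Y}$ starts from $x$, i.e. $Y_t=x+L_t$ where $L$ is the Lévy process started from $0$; $\mathbb{P}^0$ is the law started from the origin. $\boldsymbol{N}$ is a Poisson process with intensity $\lambda>0$, independent of $\boldsymbol{Y}$, with arrival times $T_1<T_2<\dots$. The process with (total) resetting $\boldsymbol{X}$ is $X_t=Y_t$ for $t<T_1$, and $X_t=Y_t-Y_{T_n}$ for $T_n\le t<T_{n+1}$, $n\ge1$ (so under $\mathbb{P}^x$ it starts at $x$ and is reset to the origin at each $T_n$). In the second part the densities $p(t,y)$ are chosen jointly Borel measurable in $(t,y)$, so that the integral makes sense. *)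

(* Defs.v *)
From HB Require Import structures.
From mathcomp Require Import all_boot all_order all_algebra.
From mathcomp Require Import all_classical all_reals all_analysis.
From mathcomp Require Import measurable_realfun.

Set Implicit Arguments.
Unset Strict Implicit.
Unset Printing Implicit Defensive.

Import Order.TTheory GRing.Theory Num.Theory.
Import numFieldNormedType.Exports.

Local Open Scope classical_set_scope.
Local Open Scope ring_scope.

Section borel_matrix.
Variables (R : realType) (m n : nat).

Definition borel_matrix_display : measure_display :=
  sigma_display (@open 'M[R]_(m, n)).

Definition borel_matrix : set (set 'M[R]_(m, n)) := <<s open >>.

Let borel_matrix0 : borel_matrix set0.
Proof. exact: sigma_algebra0. Qed.

Let borel_matrixC A : borel_matrix A -> borel_matrix (~` A).
Proof. exact: sigma_algebraC. Qed.

Let borel_matrix_bigcup (F : (set 'M[R]_(m, n))^nat) :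
  (forall i, borel_matrix (F i)) -> borel_matrix (\bigcup_i F i).
Proof. exact: sigma_algebra_bigcup. Qed.

HB.instance Definition _ := @isMeasurable.Build borel_matrix_display
  'M[R]_(m, n) borel_matrix borel_matrix0 borel_matrixC borel_matrix_bigcup.

End borel_matrix.

Lemma measurable_fun_matrix (R : realType) (m n : nat) (dT : measure_display)
    (T : measurableType dT) (f : T -> 'M[R]_(m, n)) :
  (forall i j, measurable_fun setT (fun w => f w i j)) -> measurable_fun setT f.
Proof.
move=> mf.
apply: (@measurability _ _ _ _ _ _ (@open 'M[R]_(m, n))) => //.
move=> _ [U oU <-]; rewrite setTI.
pose c (qk : 'M[rat]_(m, n) * nat) : 'M[R]_(m, n) := map_mx ratr qk.1.
pose r (qk : 'M[rat]_(m, n) * nat) : R := qk.2.+1%:R^-1.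
pose V qk := if `[< ball (c qk) (r qk) `<=` U >]
  then [set w | forall i j, ball (c qk i j) (r qk) (f w i j)] else set0.
have -> : f @^-1` U = \bigcup_qk V qk.
  apply/seteqP; split => [w Uw|w [qk _]]; last first.
    rewrite /V; case: ifPn => // /asboolP sU /= b; apply: sU; split => //.
    by rewrite /r invr_gt0 ltr0n.
  have /nbhs_ballP[e /= e0 eU] : nbhs (f w) U by exact: open_nbhs_nbhs.
  have [k /= ke] : exists k : nat, k.+1%:R^-1 < e / 2.
    by have [k _ H] := near_infty_natSinv_lt (PosNum (divr_gt0 e0 (ltr0n _ 2)));
      exists k; exact: (H k (leqnn k)).
  have kp : 0 < k.+1%:R^-1 :> R by rewrite invr_gt0 ltr0n.
  have dq (x : R) : exists q : rat, ball (ratr q : R) k.+1%:R^-1 x.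
    have [|q] := @rat_in_itvoo R (x - k.+1%:R^-1) (x + k.+1%:R^-1).
      by rewrite ltrD2l (lt_trans _ kp)// oppr_lt0.
    rewrite in_itv/= => /andP[q1 q2]; exists q.
    by rewrite -ball_normE/= distrC ltr_distl ltrBlDr q2 -ltrBlDr.
  have [q qP] := choice dq.
  exists (\matrix_(i, j) q (f w i j), k) => //; rewrite /V ifT.
    by move=> i j; rewrite /= /c /r/= !mxE; exact: qP.
  apply/asboolP => v /= [_ qv]; apply: eU; split => // i j.
  have := qv i j; rewrite /c /r/= !mxE => {}qv.
  apply: (@le_ball _ _ _ (k.+1%:R^-1 + k.+1%:R^-1)).
    by rewrite (splitr e) lerD// ltW.
  by apply: (ball_triangle _ qv); apply: ball_sym; exact: qP.
apply: countable_bigcupT_measurable => [|[q k]]; first exact: countableP.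
rewrite /V; case: ifPn => // _.
rewrite [X in measurable X](_ : _ =
    \bigcap_(ij in [set: 'I_m * 'I_n])
      (fun w => f w ij.1 ij.2) @^-1` ball (c (q, k) ij.1 ij.2) (r (q, k))).
  apply: fin_bigcap_measurable => // -[i j] _.
  by rewrite -[X in measurable X]setTI; apply: mf => //; exact: measurable_ball.
by apply/seteqP; split => [w H [i j] _|w H i j]; [exact: H|exact: (H (i, j))].
Qed.

Lemma measurable_coord (R : realType) (m n : nat) (i : 'I_m) (j : 'I_n) :
  measurable_fun setT (fun M : 'M[R]_(m, n) => M i j).
Proof.
apply: (measurability _ (RGenOpens.measurableE R)) => //.
move=> _ [_ [a [b ->] <-]]; rewrite setTI; apply: sub_sigma_algebra.
apply: open_comp; last exact: interval_open.
by move=> M _; exact: coord_continuous.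
Qed.

Definition rV_cons (R : realType) (n : nat) (z : measurableTypeR R * 'rV[R]_n) : 'rV[R]_n.+1 :=
  row_mx (z.1 : R)%:M z.2.

Definition rV_uncons (R : realType) (n : nat) (v : 'rV[R]_n.+1) :
    measurableTypeR R * 'rV[R]_n :=
  (v 0 0, rsubmx (v : 'rV_(1 + n))).

Lemma rV_consK (R : realType) (n : nat) :
  cancel (@rV_cons R n) (@rV_uncons R n).
Proof.
case=> a v; rewrite /rV_uncons /rV_cons row_mxKr; congr pair.
by rewrite /row_mx mxE; case: splitP => //= j _; rewrite !mxE [j]ord1.
Qed.

Lemma rV_cons0 (R : realType) (n : nat) (z : measurableTypeR R * 'rV[R]_n) :
  rV_cons z 0 0 = z.1.
Proof. exact: (congr1 fst (rV_consK z)). Qed.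

Lemma rV_consS (R : realType) (n : nat) (z : measurableTypeR R * 'rV[R]_n)
  (i : 'I_n) : rV_cons z 0 (lift ord0 i) = z.2 0 i.
Proof.
have := congr1 (fun u : _ * 'rV[R]_n => u.2 0 i) (rV_consK z); rewrite /= mxE => <-.
by congr (_ _ _); exact: val_inj.
Qed.

Lemma measurable_rV_cons (R : realType) (n : nat) :
  measurable_fun setT (@rV_cons R n).
Proof.
apply: measurable_fun_matrix => i j; rewrite /rV_cons ord1.
under eq_fun do rewrite /row_mx mxE.
case: splitP => k _.
  by under eq_fun do rewrite mxE [k]ord1; exact: measurable_fst.
exact: (measurableT_comp (@measurable_coord R 1 n 0 k) measurable_snd).
Qed.

Lemma measurable_rV_uncons (R : realType) (n : nat) :
  measurable_fun setT (@rV_uncons R n).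
Proof.
apply/measurable_fun_pair; first exact: measurable_coord.
apply: measurable_fun_matrix => i j.
by under eq_fun do rewrite /= mxE; exact: measurable_coord.
Qed.

Section lebesgue_rV_succ.
Context (R : realType) (n : nat).
Variable mu : {sigma_finite_measure set 'rV[R]_n -> \bar R}.

Definition lebesgue_rV_succ : set 'rV[R]_n.+1 -> \bar R :=
  pushforward (lebesgue_measure \x mu)%E (@rV_cons R n).

HB.instance Definition _ := Measure.copy lebesgue_rV_succ
  (measure_function_pushforward__canonical__measure_function_Measure
    (lebesgue_measure \x mu)%E (@measurable_rV_cons R n)).

Let sigma_finite_lebesgue_rV_succ : sigma_finite setT lebesgue_rV_succ.
Proof.
have /sigma_finiteP[F [TF ndF Foo]] := sigma_finiteT (@lebesgue_measure R).
have /sigma_finiteP[G [TG ndG Goo]] := sigma_finiteT mu.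
exists (fun k => @rV_uncons R n @^-1` (F k `*` G k)).
  apply/seteqP; split => // v _; set z := rV_uncons v.
  have [k1 _ Fk] : (\bigcup_k F k) z.1 by rewrite -TF.
  have [k2 _ Gk] : (\bigcup_k G k) z.2 by rewrite -TG.
  exists (maxn k1 k2) => //; split; rewrite /= -/z.
    by apply: (subsetPset _ _ (ndF _ _ (leq_maxl k1 k2))) Fk.
  by apply: (subsetPset _ _ (ndG _ _ (leq_maxr k1 k2))) Gk.
move=> k; have [mF Fk] := Foo k; have [mG Gk] := Goo k; split.
  rewrite -[X in measurable X]setTI; apply: measurable_rV_uncons => //.
  exact: measurableX.
rewrite /lebesgue_rV_succ /pushforward (_ : _ @^-1` _ = F k `*` G k).
  by rewrite product_measure1E// lte_mul_pinfty// ge0_fin_numE.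
by apply/funext => z; rewrite /preimage /mkset rV_consK.
Qed.

HB.instance Definition _ := @Measure_isSigmaFinite.Build _ _ _
  lebesgue_rV_succ sigma_finite_lebesgue_rV_succ.

End lebesgue_rV_succ.

Fixpoint lebesgue_rV (R : realType) (n : nat) :
    {sigma_finite_measure set 'rV[R]_n -> \bar R} :=
  match n with
  | 0 => \d_(0 : 'rV[R]_0)
  | n'.+1 => lebesgue_rV_succ (lebesgue_rV R n')
  end.

Lemma lebesgue_rV_box (R : realType) (n : nat) (a b : 'rV[R]_n) :
  (forall i, a 0 i <= b 0 i) ->
  lebesgue_rV R n [set v | forall i, v 0 i \in `[a 0 i, b 0 i]] =
  (\prod_(i < n) (b 0 i - a 0 i))%:E.
Proof.
elim: n a b => [|n IH] a b ab.
  by rewrite big_ord0 /= diracE mem_set//= => -[].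
pose a' := \row_i a 0 (lift ord0 i); pose b' := \row_i b 0 (lift ord0 i).
have ab' i : a' 0 i <= b' 0 i by rewrite !mxE.
set B := mkset _.
transitivity
  ((lebesgue_measure \x lebesgue_rV R n)%E (@rV_cons R n @^-1` B)) => //.
have -> : @rV_cons R n @^-1` B =
  (`[a 0 0, b 0 0]%classic : set (measurableTypeR R)) `*`
  [set v : 'rV[R]_n | forall i, v 0 i \in `[a' 0 i, b' 0 i]].
  apply/seteqP; split => z; rewrite /B.
    move=> H; split; first by have := H 0; rewrite rV_cons0.
    by move=> i; have := H (lift ord0 i); rewrite rV_consS !mxE.
  move=> [H0 H] i; case: (unliftP ord0 i) => [j|] ->; last by rewrite rV_cons0.
  by have := H j; rewrite rV_consS !mxE.
rewrite product_measure1E//; last first.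
  rewrite (_ : [set v | _] = \bigcap_(i in setT)
     (fun v : 'rV[R]_n => v 0 i) @^-1` `[a' 0 i, b' 0 i]).
    apply: fin_bigcap_measurable => // i _.
    by rewrite -[X in measurable X]setTI; apply: measurable_coord.
  by apply/seteqP; split => v /= H i => [_|]; exact: H.
rewrite IH// big_ord_recl EFinM; congr (_ * _)%E.
  apply: eq_trans (lebesgue_measure_itv `[a 0 0, b 0 0]) _; rewrite /= lte_fin.
  have := ab 0; rewrite le_eqVlt => /orP[/eqP->|->//].
  by rewrite ltxx subrr.
by congr EFin; apply: eq_bigr => i _; rewrite !mxE.
Qed.

Section processes.
Context (dO : measure_display) (Omega : measurableType dO) (R : realType).
Variable P : probability Omega R.

(* Processes are indexed by all of [R] for convenience; only their values at
   times [0 <= t] are ever constrained or used. *)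

(* Subfamilies are covered by taking some of the [A i] to be [setT]. *)
Definition independent_RVs (dT : measure_display) (T : measurableType dT)
    (n : nat) (Z : 'I_n -> Omega -> T) : Prop :=
  forall A : 'I_n -> set T, (forall i, measurable (A i)) ->
    P (\bigcap_(i in [set: 'I_n]) Z i @^-1` A i) =
    (\prod_(i < n) P (Z i @^-1` A i))%E.

Definition process_sigma_algebra (dT : measure_display) (T : measurableType dT)
    (Z : R -> Omega -> T) : set (set Omega) :=
  <<s [set B | exists t A, [/\ 0 <= t, measurable A & B = Z t @^-1` A]] >>.

Definition independent_processes (dT dU : measure_display)
    (T : measurableType dT) (U : measurableType dU)
    (Z : R -> Omega -> T) (W : R -> Omega -> U) : Prop :=
  forall A B, process_sigma_algebra Z A -> process_sigma_algebra W B ->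
    P (A `&` B) = (P A * P B)%E.

Definition cadlag (T : topologicalType) (f : R -> T) : Prop :=
  (forall t, 0 <= t -> f s @[s --> t^'+] --> f t) /\
  (forall t, 0 < t -> exists l : T, f s @[s --> t^'-] --> l).

(* Only [t 0, ..., t n] matter for [n] increments; any finite partition
   extends to a sequence by repeating its last point. *)
Definition time_partition (t : nat -> R) : Prop :=
  0 <= t 0%N /\ forall i, t i <= t i.+1.

Record levy_process (d : nat) (L : R -> Omega -> 'rV[R]_d) : Prop := {
  levy_measurable : forall t, 0 <= t -> measurable_fun setT (L t);
  levy_start : {ae P, forall w, L 0 w = 0};
  levy_independent_increments : forall (n : nat) (t : nat -> R),
    time_partition t ->
    independent_RVs (fun (i : 'I_n) w => L (t i.+1) w - L (t i) w);
  levy_stationary_increments : forall s t A, 0 <= s -> 0 <= t -> measurable A ->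
    P ((fun w => L (s + t) w - L s w) @^-1` A) =
    P ((fun w => L t w - L 0 w) @^-1` A);
  levy_stochastic_continuity : forall t e, 0 <= t -> 0 < e ->
    P [set w | e < `|L s w - L t w|] @[s --> within `[0, +oo[ (nbhs t)]
      --> 0%E;
  levy_cadlag : forall w, cadlag (L ^~ w)
}.

Record poisson_process (lambda : R) (N : R -> Omega -> nat) : Prop := {
  poisson_measurable : forall t, 0 <= t -> measurable_fun setT (N t);
  poisson_start : forall w, N 0 w = 0%N;
  poisson_nondecreasing : forall w s t, 0 <= s <= t -> (N s w <= N t w)%N;
  poisson_cadlag : forall w, cadlag (N ^~ w);
  poisson_independent_increments : forall (n : nat) (t : nat -> R),
    time_partition t ->
    independent_RVs (fun (i : 'I_n) w => (N (t i.+1) w - N (t i) w)%N);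
  poisson_increments_law : forall s t k, 0 <= s < t ->
    P [set w | (N t w - N s w)%N = k] =
    (poisson_pmf (lambda * (t - s)) k)%:E
}.

(* [ereal_inf] gives the value [+oo] when the [n]-th arrival never occurs. *)
Definition arrival_time (N : R -> Omega -> nat) (n : nat) (w : Omega) : \bar R :=
  ereal_inf [set s%:E | s in [set s | 0 <= s /\ (n <= N s w)%N]].

Definition started_at (d : nat) (x : 'rV[R]_d) (L : R -> Omega -> 'rV[R]_d)
    (t : R) (w : Omega) : 'rV[R]_d := x + L t w.

(* For [T = arrival_time N] with [N] cadlag and nondecreasing, and [1 <= n],
   [T n <= t < T n.+1] holds exactly for
   [n = N t], so the two clauses determine [X t w] for every [w] and [0 <= t];
   [T n w] is finite in the second one. *)
Definition total_resetting (d : nat) (Y : R -> Omega -> 'rV[R]_d)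
    (T : nat -> Omega -> \bar R) (X : R -> Omega -> 'rV[R]_d) : Prop :=
  forall t w, 0 <= t ->
    ((t%:E < T 1%N w)%E -> X t w = Y t w) /\
    (forall n, (1 <= n)%N -> (T n w <= t%:E)%E -> (t%:E < T n.+1 w)%E ->
      X t w = Y t w - Y (fine (T n w)) w).

Definition absolutely_continuous_RV (d : nat) (Z : Omega -> 'rV[R]_d) : Prop :=
  pushforward P Z `<< lebesgue_rV R d.

Definition has_density (d : nat) (Z : Omega -> 'rV[R]_d)
    (f : 'rV[R]_d -> \bar R) : Prop :=
  [/\ measurable_fun setT f, forall y, (0 <= f y)%E &
    forall A, measurable A -> P (Z @^-1` A) =
      (\int[lebesgue_rV R d]_(y in A) f y)%E].

End processes.

(* Extended-real valued: the integral may be infinite, e.g. at [y = 0] for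
   Brownian motion in dimension [2 <= d]. *)
Definition resetting_density (R : realType) (d : nat) (lambda : R)
    (p : R -> 'rV[R]_d -> \bar R) (t : R) (x y : 'rV[R]_d) : \bar R :=
  ((expR (- lambda * t))%:E * p t (y - x)%R +
   \int[lebesgue_measure]_(s in `]0%R, t[)
     ((lambda * expR (- lambda * s))%:E * p s y))%E.

(* Main.v *)
(* Let g be the last arrival before t (0 if there is none) and h = t - g its age.
   On {h = t} nothing has been reset and X_t = x + L_t; on {h < t} one has
   X_t = L_t - L_{t-h}. For 0 < s <= t, {h < s} says that N jumps in
   ]t - s, t], so h has on [0, t[ the exponential density of rate lambda. As h is sigma(N)-measurable,
   it is independent of L, and (s, w) |-> L_t w - L_{t-s} w is jointly
   measurable by right-continuity of the paths, so the second event can be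
   computed by conditioning on h = s, where L_t - L_{t-s} has the law of L_s.
   The density statement then follows from Tonelli's theorem and the
   translation invariance of the Lebesgue measure. *)

Require Import Defs.
From HB Require Import structures.
From mathcomp Require Import all_boot all_order all_algebra.
From mathcomp Require Import all_classical all_reals all_analysis.
From mathcomp Require Import measurable_realfun.

Import Order.TTheory GRing.Theory Num.Theory.
Import numFieldNormedType.Exports.

Local Open Scope classical_set_scope.
Local Open Scope ring_scope.

Set Implicit Arguments.
Unset Strict Implicit.
Unset Printing Implicit Defensive.

(** * Arrival times of a right-continuous nondecreasing counting path *)

Section arrival.
Context (R : realType) (dO : measure_display) (Omega : measurableType dO)
  (N : R -> Omega -> nat) (w : Omega).
Context (Nmono : forall s t : R, 0 <= s <= t -> (N s w <= N t w)%N)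
  (Nright : forall t : R, 0 <= t -> N s w @[s --> t^'+] --> N t w).

(** In the discrete topology of [nat] a singleton is a neighbourhood, so the right limit is reached
    at some point after [v]. By monotonicity the path is then constant on [[v, v + e]]. *)
Lemma nat_right_constant (v : R) : 0 <= v ->
  exists2 e : R, 0 < e & N (v + e) w = N v w.
Proof.
move=> v0; have : \forall s \near v^'+, N s w = N v w.
  have /(_ [set N v w]) := Nright v0; apply.
  by rewrite nbhs_principalE; exact/principal_filterP.
move=> H.
have H2 : \forall s \near v^'+, v < s /\ N s w = N v w.
  near=> s; split; last by near: s.
  by near: s; exact: nbhs_right_gt.
have [s [vs <-]] := @filter_ex _ _ _ _ H2.
by exists (s - v); [rewrite subr_gt0|rewrite addrC subrK].
Unshelve. all: by end_near. Qed.

(** Right-continuity makes the infimum attained: if [N v w < n], the path stays below [n] up to some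
    [v + e], which bounds the arrival time away from [v]. *)
Lemma arrival_time_le (n : nat) (v : R) : 0 <= v ->
  (arrival_time N n w <= v%:E)%E = (n <= N v w)%N.
Proof.
move=> v0; apply/idP/idP => [|nv]; last first.
  by apply: ereal_inf_lbound; exists v.
apply: contraTT; rewrite -ltnNge -ltNge => Nvn.
have [e e0 Ne] := nat_right_constant v0.
apply: (@lt_le_trans _ _ (v + e)%:E); first by rewrite lte_fin ltrDl.
apply: le_ereal_inf_tmp => _ [s [s0 ns] <-]; rewrite lee_fin.
rewrite leNgt; apply/negP => sve.
have := Nmono (s := s) (t := v + e); rewrite s0 ltW// => /(_ isT).
by rewrite Ne leqNgt (leq_trans Nvn).
Qed.

Lemma arrival_time_ge0 (n : nat) : (0 <= arrival_time N n w)%E.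
Proof. by apply: le_ereal_inf_tmp => _ [s [s0 _] <-]; rewrite lee_fin. Qed.

(** When [N t w = 0] the infimum runs over all nonnegative times, which gives the value 0. *)
Definition last_arrival (t : R) : R := fine (arrival_time N (N t w) w).

Lemma last_arrival_fin (t : R) : 0 <= t ->
  (last_arrival t)%:E = arrival_time N (N t w) w.
Proof.
move=> t0; rewrite fineK// ge0_fin_numE ?arrival_time_ge0//.
by rewrite (@le_lt_trans _ _ t%:E) ?ltry// arrival_time_le.
Qed.

Lemma last_arrival_ge0 (t : R) : 0 <= last_arrival t.
Proof. exact/fine_ge0/arrival_time_ge0. Qed.

Lemma last_arrival_le (t v : R) : 0 <= t -> 0 <= v ->
  (last_arrival t <= v) = (N t w <= N v w)%N.
Proof. by move=> t0 v0; rewrite -lee_fin last_arrival_fin// arrival_time_le. Qed.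

End arrival.

(** * Joint law of two independent random elements *)

Section independent_pair.
Local Open Scope ereal_scope.
Context d d1 d2 (T : measurableType d) (T1 : measurableType d1)
  (T2 : measurableType d2) (R : realType) (P : probability T R).
Context (X : {mfun T >-> T1}) (Y : {mfun T >-> T2}).
Context (indepXY : forall A B, measurable A -> measurable B ->
  P (X @^-1` A `&` Y @^-1` B) = P (X @^-1` A) * P (Y @^-1` B)).

Lemma independent_pair_law (C : set (T1 * T2)) : measurable C ->
  P [set w | C (X w, Y w)] =
  \int[distribution P Y]_y P (X @^-1` ysection C y).
Proof.
move=> mC.
have mXY : measurable_fun setT (fun w => (X w, Y w)).
  by apply/measurable_fun_pair; exact: measurable_funPT.
pose XY : {mfun T >-> (T1 * T2)%type} :=
  HB.pack (fun w => (X w, Y w)) (isMeasurableFun.Build _ _ _ _ _ mXY).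
rewrite (_ : P _ = distribution P XY C)//.
(* Independence identifies the joint law with the product measure on rectangles, hence everywhere.
   The same uniqueness then passes to the product [\x^], which integrates over the second variable
   last. *)
transitivity ((distribution P X \x distribution P Y) C).
  by apply/esym/product_measure_unique.
by apply: (@product_measure_unique _ _ _ _ _ _ _
  (distribution P X \x^ distribution P Y)) => // A B mA mB;
  exact: product_measure2E.
Qed.

End independent_pair.

(** * Conditioning on a variable whose law has a density on part of the line *)

Section independent_pair_density.
Local Open Scope ereal_scope.
Context d d2 (T : measurableType d) (T2 : measurableType d2) (R : realType)
  (P : probability T R).
Context (X : {mfun T >-> measurableTypeR R}) (Y : {mfun T >-> T2}).
Context (indepXY : forall A B, measurable A -> measurable B ->
  P (X @^-1` A `&` Y @^-1` B) = P (X @^-1` A) * P (Y @^-1` B)).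
Context (D : set (measurableTypeR R)) (f : R -> R).
Context (mD : measurable D) (mf : measurable_fun setT f)
  (f_ge0 : forall s, (0 <= f s)%R)
  (densX : forall B : set (measurableTypeR R), measurable B -> B `<=` D ->
     P (X @^-1` B) = \int[lebesgue_measure]_(s in B) (f s)%:E).

(** Each section of [C] at a fixed [y] lies in [D], so its probability is an integral of [f].
    Tonelli's theorem then exchanges the order of integration; what [X] does outside [D] never
    enters. *)
Lemma independent_pair_density (C : set (measurableTypeR R * T2)) :
  measurable C -> C `<=` D `*` setT ->
  P [set w | C (X w, Y w)] =
  \int[lebesgue_measure]_(s in D) ((f s)%:E * P (Y @^-1` xsection C s)).
Proof.
move=> mC CD; rewrite independent_pair_law//.
pose F (z : measurableTypeR R * T2) := (f z.1)%:E * (\1_C z)%:E.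
have mF : measurable_fun setT F.
  apply: emeasurable_funM; apply/measurable_EFinP => //.
  exact: (measurableT_comp mf measurable_fst).
have F0 z : 0 <= F z by rewrite /F mule_ge0// lee_fin.
transitivity (\int[distribution P Y]_y \int[lebesgue_measure]_s F (s, y)).
  apply: eq_integral => y _.
  have mCy : measurable (ysection C y) by exact: measurable_ysection.
  rewrite densX//; last by move=> s; rewrite /ysection/= inE => /CD[].
  rewrite integral_mkcond; apply: eq_integral => s _.
  rewrite /F/= epatch_indic; congr (_ * (_)%:E).
  by rewrite !indicE mem_ysection.
rewrite -fubini_tonelli// [RHS]integral_mkcond; apply: eq_integral => s _.
rewrite patchE /F/=.
have mCs : measurable (xsection C s) by exact: measurable_xsection.
have m1C : measurable_fun setT (fun y => \1_C (s, y) : R).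
  rewrite (_ : (fun y => _) = \1_(xsection C s)); last first.
    by apply/funext => y; rewrite !indicE mem_xsection.
  exact: measurable_indic.
rewrite ge0_integralZl ?lee_fin//; last exact/measurable_EFinP.
transitivity ((f s)%:E * distribution P Y (xsection C s)).
  rewrite -[in RHS](setIT (xsection C s)) -integral_indic//; congr (_ * _).
  by apply: eq_integral => y _; rewrite !indicE mem_xsection.
case: ifPn => [//|/negP sD]; rewrite (_ : xsection C s = set0) ?measure0 ?mule0//.
apply/seteqP; split => // y; rewrite /xsection/= inE => /CD[/= sD' _].
by case: sD; rewrite inE.
Qed.

End independent_pair_density.

(** * Identification of a measure with the exponential law below a level *)

Section exponential_below.
Local Open Scope ereal_scope.
Context (R : realType) (lambda t : R) (lambda_gt0 : (0 < lambda)%R).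
Context (nu : {measure set (measurableTypeR R) -> \bar R}).
Context (nu_lt : forall s : R, (s <= t)%R ->
  nu `]-oo, s[%classic = exponential_prob lambda `]-oo, s[%classic).

Lemma measure_eq_exponential_below (B : set (measurableTypeR R)) :
  measurable B -> B `<=` `]-oo, t[ -> nu B = exponential_prob lambda B.
Proof.
move=> mB Bt.
pose e : {measure set (measurableTypeR R) -> \bar R} :=
  exponential_distribution_exponential_prob__canonical__measure_function_Measure lambda_gt0.
have mt : measurable (`]-oo, t[%classic : set (measurableTypeR R)).
  exact: measurable_itv.
(* Both measures are restricted to []-oo, t[], where they are finite. A ray ending at [x] then
   counts as the ray ending at [Num.min x t], to which [nu_lt] applies, and rays form a generating
   class stable under intersection. *)
rewrite -(setIidl Bt) -[LHS]/(mrestr nu mt B) -[RHS]/(mrestr e mt B).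
apply: (@measure_unique _ _ (measurableTypeR R) (@RGenInftyO.G R)
  (fun k => `]-oo, k%:R[%classic)
  _ _ _ _ (mrestr nu mt) (mrestr e mt)) => //=.
- exact: RGenInftyO.measurableE.
- move=> _ _ [x ->] [y ->]; exists (Num.min x y); apply/seteqP.
  by split => z /=; rewrite !in_itv/= lt_min => /andP.
- by move=> k; exists k%:R.
- apply/seteqP; split => // x _; exists (Num.bound `|x|) => //=.
  by rewrite in_itv/= (le_lt_trans (ler_norm _))// archi_boundP.
- move=> _ [x ->]; rewrite /mrestr.
  rewrite (_ : _ `&` _ = `]-oo, (Num.min x t)[%classic); last first.
    by apply/seteqP; split => z /=; rewrite !in_itv/= lt_min => /andP.
  by rewrite nu_lt// ge_min lexx orbT.
- move=> k; rewrite /mrestr/=.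
  apply: (@le_lt_trans _ _ (nu `]-oo, t[%classic)).
    by apply: le_measure; rewrite ?inE//; apply: measurableI => //;
      exact: measurable_itv.
  by rewrite nu_lt// (le_lt_trans (probability_le1 _ _)) ?ltry.
Qed.

End exponential_below.

(** * Joint measurability of right-continuous processes *)

Section right_grid.
Context (R : realType).

(** This is the least multiple of [n.+1%:R^-1] strictly above [Num.max 0 s], since [Num.truncn]
    vanishes on negative reals. Strictness lets the grid points converge from the right, as
    right-continuity requires. *)
Definition right_grid (n : nat) (s : R) : R :=
  (Num.truncn (n.+1%:R * s)).+1%:R / n.+1%:R.

Lemma right_grid_gt n s : Num.max 0 s < right_grid n s.
Proof.
rewrite gt_max divr_gt0//= ltr_pdivlMr// mulrC.
exact: truncnS_gt.
Qed.

Lemma right_grid_le n s : right_grid n s <= Num.max 0 s + n.+1%:R^-1.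
Proof.
rewrite /right_grid -[_.+1]addn1 natrD mulrDl mul1r lerD2r.
rewrite ler_pdivrMr//; have [s0|s0] := leP 0 s.
  by rewrite mulrC truncn_le mulr_ge0.
rewrite mul0r; suff -> : Num.truncn (n.+1%:R * s) = 0%N by [].
apply/eqP; rewrite -leqn0 truncn_le_nat (@le_lt_trans _ _ 0)//.
by rewrite mulr_ge0_le0// ltW.
Qed.

Lemma right_grid_cvg s : right_grid n s @[n --> \oo] --> Num.max 0 s.
Proof.
apply: (@squeeze_cvgr _ _ _ _ (cst (Num.max 0 s))
  (fun n => Num.max 0 s + n.+1%:R^-1)).
- by apply: nearW => n; rewrite (ltW (right_grid_gt _ _)) right_grid_le.
- exact: cvg_cst.
- rewrite -[X in _ --> X]addr0; apply: cvgD; first exact: cvg_cst.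
  exact: cvg_harmonic.
Qed.

Lemma measurable_right_grid_comp (d d' : measure_display)
    (T : measurableType d) (U : measurableType d') (X : R -> T -> U) n :
  (forall s, 0 <= s -> measurable_fun setT (X s)) ->
  measurable_fun setT
    (fun z : measurableTypeR R * T => X (right_grid n z.1) z.2).
Proof.
move=> mX _ B mB; rewrite setTI.
pose lev k : set (measurableTypeR R) :=
  (fun s => (Num.truncn (n.+1%:R * s))%:R : R) @^-1` [set k%:R].
have mlev k : measurable (lev k).
  rewrite /lev -[X in measurable X]setTI.
  apply: nondecreasing_measurable => // s t st.
  by rewrite ler_nat le_truncn// ler_pM2l.
rewrite (_ : _ @^-1` _ = \bigcup_k
    (lev k `*` (X (k.+1%:R / n.+1%:R) @^-1` B))).
  apply: bigcupT_measurable => k; apply: measurableX => //.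
  by rewrite -[X in measurable X]setTI; apply: mX => //; rewrite divr_ge0.
apply/seteqP; split => [[s w] /= Xsw|[s w] [k _ [/= /eqP]]].
  by exists (Num.truncn (n.+1%:R * s)).
by rewrite eqr_nat => /eqP; rewrite /right_grid => ->.
Qed.

(* A process with right-continuous paths is the limit of the processes frozen
   on the grids, so it is measurable jointly in time and chance. *)
Lemma measurable_right_continuous_process (d : measure_display)
    (T : measurableType d) (m n : nat) (X : R -> T -> 'M[R]_(m, n)) :
  (forall s, 0 <= s -> measurable_fun setT (X s)) ->
  (forall w s, 0 <= s -> X u w @[u --> s^'+] --> X s w) ->
  measurable_fun setT
    (fun z : measurableTypeR R * T => X (Num.max 0 z.1) z.2).
Proof.
move=> mX cX; apply: measurable_fun_matrix => i j.
apply: (measurable_fun_cvg (h := fun k z => X (right_grid k z.1) z.2 i j)).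
  move=> k; apply: (measurableT_comp (@measurable_coord R m n i j)).
  exact: measurable_right_grid_comp.
move=> [s w] _ /=; set r := Num.max 0 s.
have r0 : 0 <= r by rewrite le_max lexx.
have : X u w i j @[u --> r^'+] --> X r w i j.
  exact: (cvg_comp _ _ (cX w r r0) (@coord_continuous R m n i j (X r w))).
(* The right limit is read along the grid points, which lie strictly above [r] and tend to it. *)
move=> /cvg_at_rightP; apply; split; last exact: right_grid_cvg.
by move=> k; exact: right_grid_gt.
Qed.

End right_grid.

(** * Tonelli's theorem on a measurable rectangle *)

Section tonelli_within.
Local Open Scope ereal_scope.
Context d1 d2 (T1 : measurableType d1) (T2 : measurableType d2) (R : realType).
Context (m1 : {sigma_finite_measure set T1 -> \bar R})
  (m2 : {sigma_finite_measure set T2 -> \bar R}).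
Context (D : set T1) (E : set T2) (f : T1 * T2 -> \bar R).
Context (mD : measurable D) (mE : measurable E)
  (mf : measurable_fun (D `*` E) f)
  (f0 : forall x y, D x -> E y -> 0 <= f (x, y)).

(** Extension by zero: [f] is only known to be measurable and nonnegative on the rectangle. *)
Let F := f \_ (D `*` E).

Let mF : measurable_fun setT F.
Proof.
exact: (proj1 (measurable_restrictT f (measurableX mD mE)) mf).
Qed.

Let F0 z : 0 <= F z.
Proof.
rewrite /F patchE; case: ifPn => //; case: z => x y.
by rewrite inE => -[/= Dx Ey]; exact: f0.
Qed.

Let integral1F y : \int[m1]_x F (x, y) =
  ((fun y => \int[m1]_(x in D) f (x, y)) \_ E) y.
Proof.
rewrite patchE; case: ifPn => [|/negP] yE.
  rewrite [RHS]integral_mkcond; apply: eq_integral => x _.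
  by rewrite /F !patchE in_setX yE andbT.
rewrite integral0_eq// => x _; rewrite /F patchE in_setX/=.
by move/negP/negbTE : yE => ->; rewrite andbF.
Qed.

Let integral2F x : \int[m2]_y F (x, y) =
  ((fun x => \int[m2]_(y in E) f (x, y)) \_ D) x.
Proof.
rewrite patchE; case: ifPn => [|/negP] xD.
  rewrite [RHS]integral_mkcond; apply: eq_integral => y _.
  by rewrite /F !patchE in_setX xD.
rewrite integral0_eq// => y _; rewrite /F patchE in_setX/=.
by move/negP/negbTE : xD => ->.
Qed.

Lemma measurable_integral_within :
  measurable_fun E (fun y => \int[m1]_(x in D) f (x, y)).
Proof.
apply: (proj2 (measurable_restrictT _ mE)).
rewrite -(funext integral1F).
exact: (@measurable_fun_fubini_tonelli_G _ _ _ _ _ m1).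
Qed.

Lemma tonelli_within :
  \int[m1]_(x in D) \int[m2]_(y in E) f (x, y) =
  \int[m2]_(y in E) \int[m1]_(x in D) f (x, y).
Proof.
rewrite integral_mkcond [RHS]integral_mkcond.
by rewrite -(funext integral1F) -(funext integral2F) fubini_tonelli.
Qed.

End tonelli_within.

(** * Translation invariance of the Lebesgue measure *)

Section lebesgue_translation.
Context (R : realType).

Lemma measurable_addl (a : R) :
  measurable_fun setT (fun x : measurableTypeR R => a + x : measurableTypeR R).
Proof. exact: measurable_funD. Qed.

Lemma measurable_addl_rV (n : nat) (v : 'rV[R]_n) :
  measurable_fun setT (fun y : 'rV[R]_n => v + y).
Proof.
apply: measurable_fun_matrix => i j; under eq_fun do rewrite mxE.
by apply: measurable_funD => //; exact: measurable_coord.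
Qed.

(** The pushforward under translation gives half-open intervals their length, which characterizes
    the Lebesgue measure. *)
Lemma lebesgue_measure_addl (a : R) (A : set (measurableTypeR R)) :
  measurable A ->
  lebesgue_measure ((fun x => a + x) @^-1` A) = lebesgue_measure A.
Proof.
move=> mA; apply/esym.
pose tau : {mfun measurableTypeR R >-> measurableTypeR R} :=
  HB.pack (fun x : measurableTypeR R => a + x : measurableTypeR R)
    (isMeasurableFun.Build _ _ _ _ _ (measurable_addl a)).
pose nu : {measure set (measurableTypeR R) -> \bar R} :=
  measure_function_pushforward__canonical__measure_function_Measure
   lebesgue_measure (measurable_addl a).
apply: (lebesgue_measure_unique (mu := nu)) => // _ [[b c] _ <-].
rewrite /nu/= /pushforward.
rewrite (_ : _ @^-1` _ = `](b - a), (c - a)]%classic); last first.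
  apply/seteqP; split => x /=; rewrite !in_itv/= ltrBlDl lerBrDl//.
rewrite !lebesgue_measure_itv/= !lte_fin ltrD2r.
by case: ifPn => // _; rewrite -!EFinB opprB addrA subrK.
Qed.

(** By induction on the dimension: through [rV_cons] a translation acts separately on the first
    coordinate and on the rest, so it preserves measures of rectangles, hence the product measure.
    In dimension 0 there is only one row. *)
Lemma lebesgue_rV_addl (n : nat) (v : 'rV[R]_n) (A : set 'rV[R]_n) :
  measurable A ->
  lebesgue_rV R n ((fun y => v + y) @^-1` A) = lebesgue_rV R n A.
Proof.
elim: n v A => [|n IH] v A mA.
  by congr (lebesgue_rV R 0 _); apply/seteqP; split => y /=;
    rewrite [v + y]thinmx0 [y]thinmx0.
pose a : R := v 0 0; pose v' : 'rV[R]_n := \row_i v 0 (lift ord0 i).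
pose tau (z : measurableTypeR R * 'rV[R]_n) : measurableTypeR R * 'rV[R]_n :=
  (a + z.1 : measurableTypeR R, v' + z.2).
have mtau : measurable_fun setT tau.
  apply/measurable_fun_pair.
    exact: (measurableT_comp (measurable_addl a) measurable_fst).
  exact: (measurableT_comp (@measurable_addl_rV n v') measurable_snd).
have consD z : v + rV_cons z = rV_cons (tau z).
  apply/rowP => i; rewrite mxE; case: (unliftP ord0 i) => [j|] ->.
    by rewrite !rV_consS !mxE.
  by rewrite !rV_cons0.
have mB : measurable (@rV_cons R n @^-1` A).
  by rewrite -[X in measurable X]setTI; exact: measurable_rV_cons.
transitivity ((lebesgue_measure \x lebesgue_rV R n)%E
  (tau @^-1` (@rV_cons R n @^-1` A))).
  rewrite -[LHS]/((lebesgue_measure \x lebesgue_rV R n)%E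
    (@rV_cons R n @^-1` ((fun y => v + y) @^-1` A))).
  by congr (_ _); apply/seteqP; split => z /=; rewrite consD.
transitivity ((lebesgue_measure \x lebesgue_rV R n)%E (@rV_cons R n @^-1` A)) => //.
pose nu : {measure set (measurableTypeR R * 'rV[R]_n) -> \bar R} :=
  measure_function_pushforward__canonical__measure_function_Measure
   (lebesgue_measure \x lebesgue_rV R n)%E mtau.
apply/esym/(product_measure_unique (m' := nu)) => // B C mB' mC.
rewrite /nu/= /pushforward (_ : _ @^-1` _ =
  ((fun x => a + x) @^-1` B) `*` ((fun y => v' + y) @^-1` C))//.
rewrite product_measure1E.
- by congr (_ * _)%E; [exact: lebesgue_measure_addl|exact: IH].
- by rewrite -[X in measurable X]setTI; exact: measurable_addl.
- by rewrite -[X in measurable X]setTI; exact: measurable_addl_rV.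
Qed.

Lemma ge0_integral_rV_addl (n : nat) (v : 'rV[R]_n) (A : set 'rV[R]_n)
    (f : 'rV[R]_n -> \bar R) : measurable A -> measurable_fun setT f ->
  (forall y, 0 <= f y)%E ->
  (\int[lebesgue_rV R n]_(y in (fun y => v + y)%R @^-1` A) f y =
   \int[lebesgue_rV R n]_(y in A) f (y - v)%R)%E.
Proof.
move=> mA mf f0.
have mfv : measurable_fun setT (fun y : 'rV[R]_n => f (y - v)).
  under eq_fun do rewrite addrC.
  exact: (measurableT_comp mf (@measurable_addl_rV n (- v))).
pose nu : {measure set 'rV[R]_n -> \bar R} :=
  measure_function_pushforward__canonical__measure_function_Measure
   (lebesgue_rV R n) (@measurable_addl_rV n v).
transitivity (\int[nu]_(y in A) f (y - v)%R)%E; last first.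
  by apply: eq_measure_integral => B mB _; exact: lebesgue_rV_addl.
rewrite ge0_integral_pushforward//; [|exact: measurable_addl_rV|
  exact: measurable_funTS].
by apply: eq_integral => y _ /=; rewrite addrAC subrr add0r.
Qed.

End lebesgue_translation.

(** * The sigma-algebra generated by a process *)

Section process_sigma.
Context (R : realType) (dO dT : measure_display) (Omega : measurableType dO)
  (T : measurableType dT) (Z : R -> Omega -> T).

Definition process_generators : set (set Omega) :=
  [set B | exists t A, [/\ 0 <= t, measurable A & B = Z t @^-1` A]].

(** A copy of [Omega] whose measurable sets are the events of [process_sigma_algebra Z].
    Measurability on it is what the independence of two processes requires of an event. *)
Definition sigma_of_process := g_sigma_algebraType process_generators.

HB.instance Definition _ := Measurable.on sigma_of_process.

Lemma sigma_of_process_measurable_at t : 0 <= t ->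
  measurable_fun [set: sigma_of_process] (Z t).
Proof.
move=> t0 _ A mA; rewrite setTI; apply: sub_sigma_algebra.
by exists t, A.
Qed.

Lemma sigma_of_process_sub :
  (forall t, 0 <= t -> measurable_fun setT (Z t)) ->
  forall B : set sigma_of_process, measurable B ->
  measurable (B : set Omega).
Proof.
move=> mZ; apply: smallest_sub; first exact: sigma_algebra_measurable.
move=> _ [t [A [t0 mA ->]]].
by rewrite -[X in measurable X]setTI; apply: mZ.
Qed.

End process_sigma.
Arguments sigma_of_process_measurable_at {R dO dT Omega T} Z [t].

(** * Law of the age of the Poisson process at time [t] *)

Section last_arrival_law.
Context (R : realType) (dO : measure_display) (Omega : measurableType dO)
  (P : probability Omega R) (lambda : R) (lambda_gt0 : 0 < lambda)
  (N : R -> Omega -> nat) (poissonN : poisson_process P lambda N)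
  (t : R) (t_gt0 : 0 < t).

Let t_ge0 : 0 <= t := ltW t_gt0.
Let Nmono w := @poisson_nondecreasing _ _ _ _ _ _ poissonN w.
Let Nright w := proj1 (@poisson_cadlag _ _ _ _ _ _ poissonN w).

Definition age (w : Omega) : R := t - last_arrival N w t.

Lemma age_ge0 w : 0 <= age w.
Proof.
by rewrite subr_ge0 (last_arrival_le (@Nmono w) (@Nright w)).
Qed.

Lemma age_le w : age w <= t.
Proof. by rewrite gerBl last_arrival_ge0. Qed.

Lemma age_lt s w : s <= t -> (age w < s) = (N (t - s) w < N t w)%N.
Proof.
move=> st; rewrite ltrBlDl -ltrBlDr.
by rewrite ltNge (last_arrival_le (@Nmono w) (@Nright w)) ?subr_ge0// -ltnNge.
Qed.

(** Measurability with respect to the process [N] alone is what later makes the age independent of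
    [L]. It is checked on rays, using [age_lt] below level [t]; above it the preimage is everything,
    as the age never exceeds [t]. *)
Lemma measurable_age :
  measurable_fun [set: sigma_of_process N] (age : _ -> measurableTypeR R).
Proof.
apply: (measurability _ (RGenInftyO.measurableE R)) => // _ [_ [s ->] <-].
rewrite setTI; have [st|ts] := leP s t; last first.
  rewrite (_ : _ @^-1` _ = setT)//; apply/seteqP; split => // w _ /=.
  by rewrite in_itv/= (le_lt_trans (age_le w)).
rewrite (_ : _ @^-1` _ = [set w | (N (t - s) w < N t w)%N]); last first.
  by apply/seteqP; split => w; rewrite /= in_itv/= age_lt.
rewrite -[X in measurable X]setTI.
apply: (@measurable_fun_ltn _ (sigma_of_process N) setT (N (t - s)) (N t)
  _ _ measurableT [set true]) => //.
  by apply: sigma_of_process_measurable_at; rewrite subr_ge0.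
exact: sigma_of_process_measurable_at.
Qed.

Lemma poisson_no_arrival s : 0 <= s < t ->
  P [set w | (N t w <= N s w)%N] = (expR (- lambda * (t - s)))%:E.
Proof.
move=> st; have /andP[s0 st'] := st.
have := poisson_increments_law poissonN 0%N st.
rewrite /poisson_pmf mulr_gt0 ?subr_gt0// expr0 fact0 invr1 !mul1r mulNr => <-.
by congr (P _); apply/seteqP; split => w /=; rewrite -subn_eq0 => /eqP.
Qed.

Lemma exponential_prob_lt (s : R) :
  exponential_prob lambda `]-oo, s[%classic =
  (if (s <= 0)%R then 0 else 1 - (expR (- lambda * s))%:E)%E.
Proof.
rewrite /exponential_prob integral_itv_bndo_bndc; last first.
  by apply/measurable_funTS/measurable_EFinP; exact: measurable_exponential_pdf.
have [s0|s0] := leP s 0.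
  rewrite -integral_itv_bndo_bndc; last first.
    by apply/measurable_funTS/measurable_EFinP; exact: measurable_exponential_pdf.
  apply: integral0_eq => x /=; rewrite in_itv/= => xs.
  by rewrite lt0_exponential_pdf// (lt_le_trans xs).
rewrite -exponential_prob_itv0c// /exponential_prob.
rewrite integral_mkcond [RHS]integral_mkcond; apply: eq_integral => x _.
rewrite !patchE !mem_setE !in_itv/=; have [x0|x0] := leP 0 x => //=.
by case: ifPn => // _; rewrite lt0_exponential_pdf.
Qed.

Lemma measurable_age_Omega :
  measurable_fun [set: Omega] (age : Omega -> measurableTypeR R).
Proof.
move=> _ B mB; rewrite setTI.
apply: (@sigma_of_process_sub _ _ _ _ _ N).
  exact: poisson_measurable poissonN.
by rewrite -[X in measurable X]setTI; exact: measurable_age.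
Qed.

Let ageN : {mfun Omega >-> measurableTypeR R} :=
  HB.pack (age : Omega -> measurableTypeR R)
    (isMeasurableFun.Build _ _ _ _ _ measurable_age_Omega).

(** Only levels below [t] are covered because the age has an atom at [t], the event of no arrival.
    For [0 < s <= t] the complement of [age w < s] is the absence of jumps after [t - s]. *)
Lemma age_law (B : set (measurableTypeR R)) : measurable B -> B `<=` `]-oo, t[ ->
  P (age @^-1` B) = exponential_prob lambda B.
Proof.
apply: (measure_eq_exponential_below lambda_gt0
  (nu := distribution P ageN)) => s st.
rewrite /= /distribution /pushforward exponential_prob_lt.
have [s0|s0] := leP s 0.
  rewrite (_ : _ @^-1` _ = set0) ?measure0//; apply/seteqP; split => // w /=.
  by rewrite in_itv/= ltNge (le_trans s0)// age_ge0.
have ts : 0 <= t - s < t by rewrite subr_ge0 st/= gtrBl.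
(* Writing [s] as [t - (t - s)] in the exponent exhibits the probability of no arrival between
   [t - s] and [t]. *)
rewrite -{2}(subKr t s) -poisson_no_arrival//.
rewrite -probability_setC; last first.
  rewrite -[X in measurable X]setTI.
  apply: (@measurable_fun_leq _ Omega setT (N t) (N (t - s))
    _ _ measurableT [set true]) => //; apply: poisson_measurable poissonN _ _ => //.
  by case/andP: ts.
congr (P _); apply/seteqP; split => w /=; by rewrite in_itv/= age_lt// ltnNge => /negP.
Qed.

End last_arrival_law.

(** * Law of the process with resetting *)

Section resetting_law.
Context (R : realType) (d : nat) (dO : measure_display)
  (Omega : measurableType dO) (P : probability Omega R)
  (L : R -> Omega -> 'rV[R]_d) (levyL : levy_process P L)
  (lambda : R) (lambda_gt0 : 0 < lambda)
  (N : R -> Omega -> nat) (poissonN : poisson_process P lambda N)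
  (indepLN : independent_processes P L N).

Lemma measurable_sub_rV (dT : measure_display) (T : measurableType dT)
    (f g : T -> 'rV[R]_d) : measurable_fun setT f -> measurable_fun setT g ->
  measurable_fun setT (fun w => f w - g w).
Proof.
move=> mf mg; apply: measurable_fun_matrix => i j.
under eq_fun do rewrite mxE mxE.
by apply: measurable_funB => //; exact: (measurableT_comp (@measurable_coord R 1 d i j)).
Qed.

Lemma measurable_started_at x s : 0 <= s ->
  measurable_fun setT (started_at x L s).
Proof.
move=> s0; apply: (measurableT_comp (@measurable_addl_rV R d x)).
exact: levy_measurable levyL _ s0.
Qed.

Lemma levy_increment_law s t (A : set 'rV[R]_d) : 0 <= s <= t -> measurable A ->
  P [set w | A (L t w - L (t - s) w)] = P (started_at 0 L s @^-1` A).
Proof.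
move=> /andP[s0 st] mA.
have ts0 : 0 <= t - s by rewrite subr_ge0.
have mLs := levy_measurable levyL s0.
have mL0 := levy_measurable levyL (lexx (0 : R)).
have := levy_stationary_increments levyL ts0 s0 mA.
rewrite subrK => ->; have [B [mB B0 LB]] := levy_start levyL.
(* Stationarity yields the law of [L s - L 0], and [L 0] vanishes only almost surely; both events
   are therefore compared off the null set [B]. *)
have off C : measurable C -> P C = P (C `\` B).
  move=> mC; rewrite (measureDI P mC mB) -[RHS]adde0; congr (_ + _)%E.
  by apply: (subset_measure0 _ _ (@subIsetr _ C B)) => //; exact: measurableI.
rewrite off; last first.
  by rewrite -[X in measurable X]setTI; exact: measurable_sub_rV.
rewrite [RHS]off; last first.
  by rewrite -[X in measurable X]setTI; exact: measurable_started_at.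
have L0 w : ~ B w -> L 0 w = 0 by move=> Bw; apply: contrapT => /LB.
by congr (P _); apply/seteqP; split => w [Aw Bw]; split => //; move: Aw;
  rewrite /= /started_at add0r L0// subr0.
Qed.

Context (t : R) (t_gt0 : 0 < t).

Let t_ge0 : 0 <= t := ltW t_gt0.
Let Nmono w := @poisson_nondecreasing _ _ _ _ _ _ poissonN w.
Let Nright w := proj1 (@poisson_cadlag _ _ _ _ _ _ poissonN w).

(** By [arrival_time_le], the index of the current inter-arrival interval is [N t w]. After a reset
    the starting point [x] cancels in the difference. *)
Lemma total_resetting_started_at (x : 'rV[R]_d)
    (X : 'rV[R]_d -> R -> Omega -> 'rV[R]_d) :
  total_resetting (started_at x L) (arrival_time N) (X x) ->
  forall w, X x t w = if N t w is 0%N then started_at x L t w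
                      else L t w - L (t - age N t w) w.
Proof.
move=> resetX w; have [X0 Xn] := resetX t w t_ge0.
have Tle n : (arrival_time N n w <= t%:E)%E = (n <= N t w)%N.
  exact: (arrival_time_le (@Nmono w) (@Nright w)).
case Nn : (N t w) => [|n].
  by apply: X0; rewrite ltNge Tle Nn.
rewrite (Xn n.+1) ?Tle ?Nn//; last by rewrite ltNge Tle Nn ltnn.
rewrite /age subKr /last_arrival Nn /started_at opprD addrACA.
by rewrite subrr add0r.
Qed.

(** [Num.max] keeps the time nonnegative for every real [z.1], so that the map is measurable on the
    whole product; it changes nothing at ages, which are at most [t]. *)
Definition age_increment (z : measurableTypeR R * sigma_of_process L) : 'rV[R]_d :=
  L t z.2 - L (Num.max 0 (t - z.1)) z.2.

Lemma measurable_age_increment : measurable_fun setT age_increment.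
Proof.
apply: measurable_sub_rV.
  exact: (measurableT_comp (sigma_of_process_measurable_at L t_ge0)
    measurable_snd).
have mflip : measurable_fun setT
    (fun z : measurableTypeR R * sigma_of_process L =>
       (t - z.1 : measurableTypeR R, z.2)).
  apply/measurable_fun_pair => //.
  by apply: measurable_funB => //; exact: measurable_fst.
apply: (measurableT_comp
  (@measurable_right_continuous_process R _ (sigma_of_process L) _ _ L _ _) mflip).
  by move=> s s0; exact: sigma_of_process_measurable_at.
by move=> w s s0; have [+ _] := levy_cadlag levyL w; exact.
Qed.

Let idL_proof : measurable_fun [set: Omega] (id : Omega -> sigma_of_process L).
Proof.
move=> _ B mB; rewrite setTI; apply: (sigma_of_process_sub _ mB).
exact: levy_measurable levyL.
Qed.

(** The identity plays the role of the whole path of [L] as a single random element, to be paired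
    with the age. *)
Let idL : {mfun Omega >-> sigma_of_process L} :=
  HB.pack (id : Omega -> sigma_of_process L)
    (isMeasurableFun.Build _ _ _ _ _ idL_proof).

Let ageN_proof := measurable_age_Omega poissonN t_gt0.
Let ageN : {mfun Omega >-> measurableTypeR R} :=
  HB.pack (age N t : Omega -> measurableTypeR R)
    (isMeasurableFun.Build _ _ _ _ _ ageN_proof).

Lemma independent_age (A : set (measurableTypeR R)) (B : set (sigma_of_process L)) :
  measurable A -> measurable B ->
  P (ageN @^-1` A `&` idL @^-1` B) = (P (ageN @^-1` A) * P (idL @^-1` B))%E.
Proof.
move=> mA mB; rewrite setIC muleC; apply: indepLN => //.
have := measurable_age poissonN t_gt0; move=> /(_ measurableT _ mA).
by rewrite setTI.
Qed.

Context (A : set 'rV[R]_d) (mA : measurable A).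

Let C : set (measurableTypeR R * sigma_of_process L) :=
  (`]-oo, t[%classic `*` setT) `&` age_increment @^-1` A.

Let mC : measurable C.
Proof.
apply: measurableI; first by apply: measurableX => //; exact: measurable_itv.
by rewrite -[X in measurable X]setTI; exact: measurable_age_increment.
Qed.

Lemma prob_age_increment : P [set w | C (age N t w, w)] =
  (\int[lebesgue_measure]_(s in `]0%R, t[)
    ((lambda * expR (- lambda * s))%:E * P (started_at 0%R L s @^-1` A)))%E.
Proof.
pose F (s : measurableTypeR R) : \bar R :=
  ((exponential_pdf lambda s)%:E * P (idL @^-1` xsection C s))%E.
have mF : measurable_fun setT F.
  apply: emeasurable_funM.
    by apply/measurable_EFinP; exact: measurable_exponential_pdf.
  exact: (measurable_fun_xsection (distribution P idL) mC).
have -> : P [set w | C (age N t w, w)] = (\int[lebesgue_measure]_(s in `]-oo, t[) F s)%E.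
  apply: (@independent_pair_density _ _ _ _ _ P ageN idL independent_age
    `]-oo, t[%classic (exponential_pdf lambda)) => //.
  - exact: measurable_exponential_pdf.
  - by move=> s; exact/exponential_pdf_ge0/ltW.
  - by move=> B mB Bt; exact: age_law.
  - by move=> z [].
(* The exponential density vanishes on negative reals; the endpoint 0 is then dropped as a null
   set. *)
transitivity (\int[lebesgue_measure]_(s in `[0%R, t[) F s)%E.
  rewrite integral_mkcond [RHS]integral_mkcond; apply: eq_integral => s _.
  rewrite !patchE !mem_setE !in_itv/=; have [s0|s0] := leP 0 s => //=.
  by case: ifPn => // _; rewrite /F lt0_exponential_pdf// mul0e.
rewrite -integral_itv_obnd_cbnd; last exact: measurable_funTS.
apply: eq_integral => s; rewrite inE/= in_itv/= => /andP[s0 st].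
rewrite /F exponential_pdfE ?ltW//; congr (_ * _)%E.
rewrite -(levy_increment_law (t := t))// ?(ltW s0) ?ltW//.
congr (P _); apply/seteqP; split => w /=.
  rewrite /xsection/= inE => -[_]; rewrite /age_increment/=.
  by rewrite max_r// subr_ge0 ltW.
move=> Aw; rewrite /xsection/= inE; split => /=.
  by rewrite in_itv.
by rewrite /age_increment/= max_r// subr_ge0 ltW.
Qed.

Lemma resetting_law (x : 'rV[R]_d) (X : 'rV[R]_d -> R -> Omega -> 'rV[R]_d) :
  total_resetting (started_at x L) (arrival_time N) (X x) ->
  P (X x t @^-1` A) =
    ((expR (- lambda * t))%:E * P (started_at x L t @^-1` A) +
     \int[lebesgue_measure]_(s in `]0%R, t[)
       ((lambda * expR (- lambda * s))%:E * P (started_at 0%R L s @^-1` A)))%E.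
Proof.
move=> /total_resetting_started_at XE.
rewrite -prob_age_increment.
have N0 w : N 0 w = 0%N by exact: poisson_start poissonN _.
have age0 w : (age N t w < t) = (0 < N t w)%N.
  by rewrite (age_lt poissonN)// subrr N0.
(* The event of no arrival up to [t], in the form of [poisson_no_arrival] with [s = 0]. *)
pose S0 : set Omega := [set w | (N t w <= N 0 w)%N].
have PS0 : P S0 = (expR (- lambda * t))%:E.
  by rewrite (poisson_no_arrival lambda_gt0 poissonN) ?lexx// subr0.
have sS0 : process_sigma_algebra N S0.
  have mle : measurable_fun [set: sigma_of_process N] (fun w => (N t w <= N 0 w)%N).
    by apply: measurable_fun_leq; exact: sigma_of_process_measurable_at.
  have mtrue : measurable [set true] by [].
  by have := mle measurableT _ mtrue; rewrite setTI.
have sA : process_sigma_algebra L (started_at x L t @^-1` A).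
  have mx : measurable_fun [set: sigma_of_process L] (started_at x L t).
    exact: (measurableT_comp (@measurable_addl_rV R d x)
      (sigma_of_process_measurable_at L t_ge0)).
  by have := mx measurableT _ mA; rewrite setTI.
(* Independence turns the first term into the probability of an intersection, and the sum into that
   of a disjoint union: no arrival up to [t], or age below [t]. *)
rewrite -PS0 muleC -indepLN// -measureU//.
- congr (P _); apply/seteqP; split => w.
    rewrite /= XE; case NE : (N t w) => [|n] Aw.
      by left; split => //; rewrite /S0/= NE.
    right; split; first by split => //=; rewrite in_itv/= age0 NE.
    by rewrite /age_increment/= max_r// subr_ge0 age_le.
  move=> [[Aw]|[[/= + _]]].
    by rewrite /S0/= N0 leqn0 => /eqP NE; rewrite XE NE.
  rewrite in_itv/= age0 XE; case NE : (N t w) => [//|n] _.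
  by rewrite /age_increment/= max_r// subr_ge0 age_le.
- apply: measurableI.
    by rewrite -[X in measurable X]setTI; exact: measurable_started_at.
  by apply: (sigma_of_process_sub _ sS0); exact: poisson_measurable poissonN.
- rewrite -[X in measurable X]setTI.
  apply: (measurable_fun_pair ageN_proof idL_proof) => //.
- apply/seteqP; split => // w [[_ +] [[/= + _] _]].
  by rewrite /S0/= in_itv/= age0 N0 leqn0 => /eqP ->.
Qed.

End resetting_law.

(** * Passage from the law to the density *)

Lemma resetting_density_integral (R : realType) (d : nat) (lambda : R)
    (p : R -> 'rV[R]_d -> \bar R) (lambda_gt0 : 0 < lambda)
    (mp : measurable_fun [set z : R * 'rV[R]_d | 0 < z.1] (fun z => p z.1 z.2))
    (mps : forall s, 0 < s -> measurable_fun setT (p s))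
    (p_ge0 : forall s y, 0 < s -> (0 <= p s y)%E)
    (t : R) (x : 'rV[R]_d) (t_gt0 : 0 < t) :
  [/\ measurable_fun setT (resetting_density lambda p t x),
    forall y, (0 <= resetting_density lambda p t x y)%E &
    forall A, measurable A ->
    (\int[lebesgue_rV R d]_(y in A) resetting_density lambda p t x y =
     (expR (- lambda * t))%:E *
       \int[lebesgue_rV R d]_(y in (fun y => x + y)%R @^-1` A) p t y +
     \int[lebesgue_measure]_(s in `]0%R, t[)
       ((lambda * expR (- lambda * s))%:E *
        \int[lebesgue_rV R d]_(y in A) p s y))%E].
Proof.
pose c (s : measurableTypeR R) : R := lambda * expR (- lambda * s).
have c0 s : 0 <= c s by rewrite mulr_ge0 ?expR_ge0// ltW.
pose f (z : measurableTypeR R * 'rV[R]_d) : \bar R := ((c z.1)%:E * p z.1 z.2)%E.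
pose D : set (measurableTypeR R) := `]0, t[%classic.
have mD : measurable D by exact: measurable_itv.
have mc : measurable_fun setT c.
  by apply: measurable_funM => //; apply: measurableT_comp => //.
have mf (A : set 'rV[R]_d) : measurable A -> measurable_fun (D `*` A) f.
  move=> mA; apply: emeasurable_funM.
    apply/measurable_EFinP/measurable_funTS.
    exact: (measurableT_comp mc measurable_fst).
  (* Joint measurability of [p] is given on positive times only; the rectangle over []0, t[] lies
     inside that half-space. *)
  apply: measurable_funS mp.
    rewrite (_ : mkset _ = `]0, +oo[%classic `*` setT).
      by apply: measurableX => //; exact: measurable_itv.
    by apply/seteqP; split => -[s y]; rewrite /= in_itv/= andbT; [|case].
  by move=> [s y] [] /=; rewrite /D/= in_itv/= => /andP[].
have f0 s y : D s -> (0 <= f (s, y))%E.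
  by rewrite /D/= in_itv/= => /andP[s0 _]; rewrite mule_ge0 ?lee_fin ?p_ge0.
have mpx : measurable_fun setT (fun y : 'rV[R]_d => p t (y - x)).
  under eq_fun do rewrite addrC.
  exact: (measurableT_comp (mps _ t_gt0) (measurable_addl_rV (- x))).
have me : measurable_fun setT
    (fun y : 'rV[R]_d => (expR (- lambda * t))%:E * p t (y - x)%R)%E.
  exact: measurable_funeM.
have mi : measurable_fun setT
    (fun y => \int[lebesgue_measure]_(s in D) f (s, y))%E.
  exact: (measurable_integral_within lebesgue_measure mD measurableT
    (mf _ measurableT) (fun s y Ds _ => f0 s y Ds)).
have e0 y : (0 <= (expR (- lambda * t))%:E * p t (y - x)%R)%E.
  by rewrite mule_ge0 ?lee_fin ?expR_ge0// p_ge0.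
have i0 y : (0 <= \int[lebesgue_measure]_(s in D) f (s, y))%E.
  by apply: integral_ge0 => s Ds; exact: f0.
split.
- exact: emeasurable_funD.
- by move=> y; exact: (adde_ge0 (e0 y) (i0 y)).
move=> A mA; rewrite /resetting_density.
rewrite (ge0_integralD _ mA (fun y _ => e0 y) (measurable_funTS me)
  (fun y _ => i0 y) (measurable_funTS mi)); congr (_ + _)%E.
  rewrite (ge0_integralZl _ mA (measurable_funTS mpx)) ?lee_fin ?expR_ge0//.
    by rewrite ge0_integral_rV_addl//; [exact: mps|move=> y; exact: p_ge0].
  by move=> y _; exact: p_ge0.
rewrite -(tonelli_within lebesgue_measure (lebesgue_rV R d) mD mA (mf _ mA)
  (fun s y Ds _ => f0 s y Ds)).
apply: eq_integral => s; rewrite inE /D/= in_itv/= => /andP[s0 _].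
rewrite /f/= (ge0_integralZl _ mA (measurable_funTS (mps _ s0))) ?lee_fin ?c0//.
by move=> y _; exact: p_ge0.
Qed.

Unset Implicit Arguments.

Theorem theorem1p1 (R : realType) (d : nat) (d_gt0 : (0 < d)%N)
    (dO : measure_display) (Omega : measurableType dO) (P : probability Omega R)
    (L : R -> Omega -> 'rV[R]_d) (levyL : levy_process P L)
    (lambda : R) (lambda_gt0 : 0 < lambda)
    (N : R -> Omega -> nat) (poissonN : poisson_process P lambda N)
    (indepLN : independent_processes P L N)
    (X : 'rV[R]_d -> R -> Omega -> 'rV[R]_d)
    (resetX : forall x,
      total_resetting (started_at x L) (arrival_time N) (X x)) :
  (forall (t : R) (x : 'rV[R]_d) (A : set 'rV[R]_d), 0 < t -> measurable A ->
    P (X x t @^-1` A) =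
    ((expR (- lambda * t))%:E * P (started_at x L t @^-1` A) +
     \int[lebesgue_measure]_(s in `]0%R, t[)
       ((lambda * expR (- lambda * s))%:E * P (started_at 0%R L s @^-1` A)))%E)
  /\
  (forall p : R -> 'rV[R]_d -> \bar R,
    measurable_fun [set z : R * 'rV[R]_d | 0 < z.1] (fun z => p z.1 z.2) ->
    (forall t, 0 < t -> has_density P (started_at 0 L t) (p t)) ->
    forall (t : R) (x : 'rV[R]_d), 0 < t ->
      absolutely_continuous_RV P (X x t) /\
      has_density P (X x t) (resetting_density lambda p t x)).
Proof.
have law t x A (t0 : 0 < t) (mA : measurable A) :=
  resetting_law levyL lambda_gt0 poissonN indepLN t0 mA (resetX x).
split; first by move=> t x A t0 mA; exact: law.
move=> p mp dens t x t0.
have [mr r0 int_r] : [/\ _, _ & _] := resetting_density_integral lambda_gt0 mp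
  (fun s s0 => let: And3 m _ _ := dens s s0 in m)
  (fun s y s0 => let: And3 _ n _ := dens s s0 in n y) x t0.
have Xdens : has_density P (X x t) (resetting_density lambda p t x).
  split => // A mA; rewrite int_r// law//.
  have mxA : measurable ((fun y => x + y) @^-1` A).
    by rewrite -[X in measurable X]setTI; exact: measurable_addl_rV.
  congr (_ * _ + _)%E.
    (* The density is that of the process started at 0, so the start [x] is moved into the set:
       [x + L t w] lies in [A] exactly when [L t w] lies in the preimage of [A] under translation by
       [x]. *)
    have [_ _ <-//] := dens t t0.
    by congr (P _); apply/seteqP; split => w; rewrite /= /started_at add0r.
  apply: eq_integral => s; rewrite inE/= in_itv/= => /andP[s0 _].
  by have [_ _ ->] := dens s s0.
(* Absolute continuity follows from the density: its integral over a Lebesgue-null set is zero. *)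
split => //; apply/null_content_dominatesP => A mA A0.
have [_ _ XA] := Xdens; rewrite /pushforward XA// null_set_integral//.
exact: measurable_funTS.
Qed.
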